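(* Let $N\in\mathbb N$. For a vector $\hat f=(\hat f_n^{k,l})_{(n,k,l)\in\mathcal J_N}$ define $\mathbf W_N\hat f\in\mathbb C^{(2N+1)^3}$ by $$(\mathbf W_N\hat f)_{k,j,l} := \mathrm i^{k-l}\sum_{n=\max\{|k|,|l|,|j|\}}^{N}\sqrt{2n+1}\; d_n^{j,k}(0)\,d_n^{j,l}(0)\,\hat f_n^{-k,-l},\qquad k,j,l=-N,\dots,N.$$ Let $W_N\colon \mathcal B_N\to \mathcal T_N$, $f\mapsto f\circ\phi$, be the band-limited double Fourier sphere (DFS) operator. Then $$W_N=\mathcal F_{\mathbb T^3}\,\mathbf W_N\,\mathcal F_{\mathrm{SO}(3)}^{-1}.$$ That is, for every $f\in\mathcal B_N$ with harmonic coefficient vector $\hat f=\mathcal F_{\mathrm{SO}(3)}^{-1}f$, the function $f\circ\phi$ is the trigonometric polynomial $\sum_{k,j,l=-N}^{N}(\mathbf W_N\hat f)_{k,j,l}\,e^{\mathrm i(k\alpha+j\beta+l\gamma)}$.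
   Context: $\mathbb T=\mathbb R/2\pi\mathbb Z$. $R_y(\cdot),R_z(\cdot)$ denote the rotations about the $y$- and $z$-axis, and $R(\alpha,\beta,\gamma)=R_z(\alpha)R_y(\beta)R_z(\gamma)$; every element of $\mathrm{SO}(3)$ has this form with $\alpha,\gamma\in\mathbb T$, $\beta\in[0,\pi]$. The Euler angle map is $\phi\colon\mathbb T^3\to\mathrm{SO}(3)$, $\phi(\alpha,\beta,\gamma)=R(\alpha,\beta,\gamma)$. $L^2(\mathrm{SO}(3))$ is taken with respect to the Haar probability measure, $d\mu(R(\alpha,\beta,\gamma))=\frac1{8\pi^2}\sin\beta\,d\alpha\,d\beta\,d\gamma$. Wigner-d functions: for $n\in\mathbb N_0$, $k,l\in\mathbb Z$, $|k|,|l|\le n$, and $x\in[-1,1]$, $$d_n^{k,l}(x)=(-1)^{\nu}\binom{2n-s}{s+a}^{1/2}\binom{s+b}{b}^{-1/2}\Big(\frac{1-x}2\Big)^{a/2}\Big(\frac{1+x}2\Big)^{b/2}P_s^{a,b}(x),$$ where $a=|k-l|$, $b=|k+l|$, $s=n-\max\{|k|,|l|\}$, $\nu=k+l$ if $k>l$ and $\nu=0$ otherwise, and $P_s^{a,b}$ is the Jacobi polynomial of degree $s$ with parameters $a,b$. Wigner-D functions: $D_n^{k,l}(R(\alpha,\beta,\gamma))=\sqrt{2n+1}\,e^{-\mathrm ik\alpha}\,d_n^{k,l}(\cos\beta)\,e^{-\mathrm il\gamma}$ for $\beta\in[0,\pi]$; they form an orthonormal basis of $L^2(\mathrm{SO}(3))$.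 $\mathcal J_N=\{(n,k,l): n=0,\dots,N,\ k,l=-n,\dots,n\}$, and $\mathcal J_\infty$ is the analogous set with $n\in\mathbb N_0$. $\mathcal B_N=\operatorname{span}\{D_n^{k,l}:(n,k,l)\in\mathcal J_N\}$ is the space of $N$-band-limited functions. $\mathcal T_N=\operatorname{span}\{e^{\mathrm i\, m\cdot x}: m\in\mathbb Z^3,\|m\|_\infty\le N\}$ on $\mathbb T^3$. The Fourier transforms are $\mathcal F_{\mathrm{SO}(3)}\colon\ell_2(\mathcal J_\infty)\to L^2(\mathrm{SO}(3))$, $\hat f\mapsto\sum\hat f_n^{k,l}D_n^{k,l}$, and $\mathcal F_{\mathbb T^3}\colon\ell_2(\mathbb Z^3)\to L^2(\mathbb T^3)$, $\hat g\mapsto\sum\hat g_{k,j,l}e^{\mathrm i(k\alpha+j\beta+l\gamma)}$ (vectors indexed by finite index sets are extended by zero). *)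

(* Defs.v *)
From mathcomp Require Import all_boot all_order all_algebra.
From mathcomp Require Import complex.
From mathcomp Require Import boolp classical_sets functions cardinality fsbigop.
From mathcomp Require Import reals topology normedtype exp trigo.
From mathcomp Require Import ring.

Set Implicit Arguments.
Unset Strict Implicit.
Unset Printing Implicit Defensive.

Import Order.TTheory GRing.Theory Num.Theory.

Local Open Scope classical_set_scope.
Local Open Scope ring_scope.

Section Defs.
Variable R : realType.
Local Notation C := R[i].

Implicit Types (n : nat) (k j l : int).

Definition expi (t : R) : C := (cos t +i* sin t)%C.

(* Only used for finite A: fsbigop sums are 0 when the support is infinite. *)
Definition fspan (I : choiceType) (X : Type) (A : set I) (e : I -> X -> C) :
    set (X -> C) :=
  [set f | exists c : I -> C, f = fun x => \sum_(i \in A) c i * e i x].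

Definition mx33 (s : seq (seq R)) : 'M[R]_3 :=
  \matrix_(i, j) nth 0 (nth [::] s i) j.

Definition is_SO3 (Q : 'M[R]_3) : bool := (Q *m Q^T == 1%:M) && (\det Q == 1).

Definition SO3 := {Q : 'M[R]_3 | is_SO3 Q}.

Definition Rz (t : R) : 'M[R]_3 :=
  mx33 [:: [:: cos t; - sin t; 0]; [:: sin t; cos t; 0]; [:: 0; 0; 1]].

Definition Ry (t : R) : 'M[R]_3 :=
  mx33 [:: [:: cos t; 0; sin t]; [:: 0; 1; 0]; [:: - sin t; 0; cos t]].

Definition Rot (a b c : R) : 'M[R]_3 := Rz a *m Ry b *m Rz c.

Lemma mx33_SO3 (s : seq (seq R)) :
  let m (i j : nat) := nth 0 (nth [::] s i) j in
  (forall i k : 'I_3, m i 0%N * m k 0%N + m i 1%N * m k 1%N + m i 2%N * m k 2%N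
     = (i == k)%:R) ->
  m 0%N 0%N * (m 1%N 1%N * m 2%N 2%N - m 1%N 2%N * m 2%N 1%N)
  - m 0%N 1%N * (m 1%N 0%N * m 2%N 2%N - m 1%N 2%N * m 2%N 0%N)
  + m 0%N 2%N * (m 1%N 0%N * m 2%N 1%N - m 1%N 1%N * m 2%N 0%N) = 1 ->
  is_SO3 (mx33 s).
Proof.
move=> m Hm Hd; apply/andP; split; apply/eqP.
  apply/matrixP => i k; rewrite !mxE !big_ord_recr big_ord0 /= add0r !mxE /=.
  exact: Hm.
rewrite -[RHS]Hd (expand_det_row _ ord0) !big_ord_recr big_ord0 /= add0r.
rewrite /cofactor !(expand_det_row _ ord0) !big_ord_recr !big_ord0 /= !add0r.
rewrite /cofactor !det_mx11 !mxE /= /bump /= -![nth 0 (nth _ _ _) _]/(m _ _).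
rewrite !addn0 !add0n !addnn /=; ring.
Qed.

Lemma Rz_SO3 t : is_SO3 (Rz t).
Proof.
have H := cos2Dsin2 t; apply: mx33_SO3 => /=; last by rewrite -[RHS]H; ring.
by move=> [[|[|[|//]]] ?] [[|[|[|//]]] ?] /=; (ring || (rewrite -[RHS]H; ring)).
Qed.

Lemma Ry_SO3 t : is_SO3 (Ry t).
Proof.
have H := cos2Dsin2 t; apply: mx33_SO3 => /=; last by rewrite -[RHS]H; ring.
by move=> [[|[|[|//]]] ?] [[|[|[|//]]] ?] /=; (ring || (rewrite -[RHS]H; ring)).
Qed.

Lemma SO3M P Q : is_SO3 P -> is_SO3 Q -> is_SO3 (P *m Q).
Proof.
move=> /andP[/eqP PP /eqP dP] /andP[/eqP QQ /eqP dQ]; apply/andP; split.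
  by rewrite trmx_mul mulmxA -(mulmxA P) QQ mulmx1 PP.
by rewrite det_mulmx dP dQ mulr1.
Qed.

Lemma Rot_SO3 a b c : is_SO3 (Rot a b c).
Proof. by rewrite !SO3M ?Rz_SO3 ?Ry_SO3. Qed.

(* Functions on the torus T^3 are represented by their (2pi-periodic in each   *)
(* variable) lifts to R^3; see phi_periodic and torus_exp_periodic.           *)
Definition phi (x : R * R * R) : SO3 :=
  let: (a, b, c) := x in exist _ (Rot a b c) (Rot_SO3 a b c).

Lemma phi_periodic a b c :
  [/\ phi (a + pi *+ 2, b, c) = phi (a, b, c),
      phi (a, b + pi *+ 2, c) = phi (a, b, c) &
      phi (a, b, c + pi *+ 2) = phi (a, b, c)].
Proof.
have Hz t : Rz (t + pi *+ 2) = Rz t by rewrite /Rz cosD2pi sinD2pi.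
have Hy t : Ry (t + pi *+ 2) = Ry t by rewrite /Ry cosD2pi sinD2pi.
by split; apply: val_inj; rewrite /= /Rot ?Hz ?Hy.
Qed.

Definition jacobi (s a b : nat) (x : R) : R :=
  \sum_(m < s.+1) 'C(s + a, s - m)%:R * 'C(s + b, m)%:R *
    ((x - 1) / 2) ^+ m * ((x + 1) / 2) ^+ (s - m).

Definition wigner_d n k l (x : R) : R :=
  let a := absz (k - l) in
  let b := absz (k + l) in
  let s := (n - maxn `|k| `|l|)%N in
  let nu := if l < k then k + l else 0 in
  (-1) ^ nu * Num.sqrt 'C(2 * n - s, s + a)%:R / Num.sqrt 'C(s + b, b)%:R
  * ((1 - x) / 2) `^ (a%:R / 2) * ((1 + x) / 2) `^ (b%:R / 2) * jacobi s a b x.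

Definition euler_angles (Q : SO3) : R * R * R :=
  xget (0, 0, 0) [set x | 0 <= x.1.2 <= pi /\ phi x = Q].

(* The value does not depend on the Euler angles chosen with beta in [0, pi]. *)
Definition wigner_D (p : nat * int * int) (Q : SO3) : C :=
  let: (n, k, l) := p in
  let: (alpha, beta, gamma) := euler_angles Q in
  (Num.sqrt (2 * n + 1)%:R)%:C%C * expi (- (k%:~R * alpha)) *
  (wigner_d n k l (cos beta))%:C%C * expi (- (l%:~R * gamma)).

Definition Jinf : set (nat * int * int) :=
  [set p | (`|p.1.2| <= p.1.1)%N /\ (`|p.2| <= p.1.1)%N].

Definition J (N : nat) : set (nat * int * int) :=
  Jinf `&` [set p | (p.1.1 <= N)%N].

Definition B (N : nat) : set (SO3 -> C) := fspan (J N) wigner_D.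

Definition torus_exp (m : int * int * int) (x : R * R * R) : C :=
  expi (m.1.1%:~R * x.1.1 + m.1.2%:~R * x.1.2 + m.2%:~R * x.2).

Lemma torus_exp_periodic m a b c :
  [/\ torus_exp m (a + pi *+ 2, b, c) = torus_exp m (a, b, c),
      torus_exp m (a, b + pi *+ 2, c) = torus_exp m (a, b, c) &
      torus_exp m (a, b, c + pi *+ 2) = torus_exp m (a, b, c)].
Proof.
have expiD (z : int) t : expi (t + z%:~R * (pi *+ 2)) = expi t.
  have nat_case (q : nat) u : expi (u + q%:R * (pi *+ 2)) = expi u.
    rewrite mulr_natl /expi.
    by rewrite (periodicn (@cosD2pi R)) (periodicn (@sinD2pi R)).
  case: z => q; first exact: nat_case.
  rewrite NegzE mulrNz mulNr -[in RHS](subrK (q.+1%:R * (pi *+ 2)) t).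
  by rewrite nat_case.
rewrite /torus_exp /=; split.
- by rewrite -[RHS](expiD m.1.1); congr expi; ring.
- by rewrite -[RHS](expiD m.1.2); congr expi; ring.
- by rewrite -[RHS](expiD m.2); congr expi; ring.
Qed.

Definition box (N : nat) : set (int * int * int) :=
  [set m | [/\ (`|m.1.1| <= N)%N, (`|m.1.2| <= N)%N & (`|m.2| <= N)%N]].

Definition T (N : nat) : set (R * R * R -> C) := fspan (box N) torus_exp.

(* ell A: the vectors indexed by A, extended by zero. *)
Definition ell (I : Type) (A : set I) : set (I -> C) :=
  [set c | forall i, ~ A i -> c i = 0].

(* FSO3 and FT3 are the Fourier transforms restricted to finitely supported  *)
(* coefficient vectors (which suffice on B N and T N), so no L^2 limit occurs. *)
Definition FSO3 (fh : nat * int * int -> C) : SO3 -> C :=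
  fun Q => \sum_(p \in Jinf) fh p * wigner_D p Q.

Definition FT3 (gh : int * int * int -> C) : R * R * R -> C :=
  fun x => \sum_(m \in [set: int * int * int]) gh m * torus_exp m x.

(* Inverse of FSO3 : ell (J N) -> B N, a bijection since the wigner_D are     *)
(* linearly independent.                                                      *)
Definition FSO3inv (N : nat) : (SO3 -> C) -> nat * int * int -> C :=
  'pinv_(fun=> (fun=> 0)) (ell (J N)) FSO3.

Definition DFS (f : SO3 -> C) : R * R * R -> C := f \o phi.

(* The sum over n is empty, and the entry 0, outside box N. *)
Definition Wmx (N : nat) (fh : nat * int * int -> C) (m : int * int * int) : C :=
  let: (k, j, l) := m in
  ('i%C : C) ^ (k - l) *
  \sum_(maxn (maxn `|k| `|l|) `|j| <= n < N.+1)
    (Num.sqrt (2 * n + 1)%:R * wigner_d n j k 0 * wigner_d n j l 0)%:C%C *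
    fh (n, - k, - l).

End Defs.

(* Main.v *)
(** The Wigner functions of degree n are the matrix entries, in normalized
    monomials, of the action of SU(2) on binary forms of degree 2n; the Jacobi
    polynomial in d_n^{k,l} is what the binomial expansion of such an entry gives
    when k >= |l|, and the other cases follow by symmetry.  In SU(2) the rotation
    about the y-axis by beta is conjugate to diag(e^{i beta/2}, e^{-i beta/2}) by a
    matrix which is, up to diagonal factors, the rotation about y by pi/2; taking
    matrix entries expands d_n^{k,l}(cos beta) as
    i^(l-k) sum_j d_n^{j,-k}(0) d_n^{j,-l}(0) e^{i j beta}.  This holds for every
    real beta once D_n^{k,l} is known to be well defined for Euler angles with
    beta outside [0, pi]: the double cover SU(2) -> SO(3) has kernel {1, -1}, which
    acts trivially on forms of even degree. *)
Require Import Defs.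
From mathcomp Require Import all_boot all_order all_algebra.
From mathcomp Require Import complex.
From mathcomp Require Import boolp classical_sets functions cardinality fsbigop.
From mathcomp Require Import reals topology normedtype exp trigo.
From mathcomp Require Import ring lra zify.
Import Order.TTheory GRing.Theory Num.Theory.
Local Open Scope classical_set_scope.
Local Open Scope ring_scope.

(** * Linear substitutions in binary forms and their matrix entries *)

Section BinaryForms.
Set Implicit Arguments.
Unset Strict Implicit.
Unset Printing Implicit Defensive.

(** Both sides count the pairs of subsets, of sizes i and j, of an m-set that meet in a points. When
    i + j <= m + a both products equal m! / D with D symmetric in i and j; otherwise both vanish. *)
Lemma trinomial_sym m i j a :
  (i <= m)%N -> (j <= m)%N -> (a <= i)%N -> (a <= j)%N ->
  ('C(m, i) * ('C(i, a) * 'C(m - i, j - a)) =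
   'C(m, j) * ('C(j, a) * 'C(m - j, i - a)))%N.
Proof.
move=> im jm ai aj; have [ijm|ijm] := leqP (i + j) (m + a); last first.
  have Z i' j' : (i' <= m)%N -> (m + a < i' + j')%N ->
      ('C(i', a) * 'C(m - i', j' - a) = 0)%N.
    by move=> im' h; rewrite [X in (_ * X)%N]bin_small ?muln0 //; lia.
  by rewrite !Z ?muln0 // [(j + i)%N]addnC.
have E i' j' : (i' <= m)%N -> (j' <= m)%N -> (a <= i')%N -> (a <= j')%N ->
    (i' + j' <= m + a)%N ->
    ('C(m, i') * ('C(i', a) * 'C(m - i', j' - a)) *
     (a`! * (i' - a)`! * ((j' - a)`! * (m + a - (i' + j'))`!)) = m`!)%N.
  move=> im' jm' ai' aj' ijm'.
  have H : (j' - a <= m - i')%N by lia.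
  rewrite -[RHS](bin_fact im') -(bin_fact ai') -(bin_fact H).
  have -> : (m - i' - (j' - a) = m + a - (i' + j'))%N by lia.
  ring.
set D := (a`! * (i - a)`! * ((j - a)`! * (m + a - (i + j))`!))%N.
have D_gt0 : (0 < D)%N by rewrite !muln_gt0 !fact_gt0.
apply/eqP; rewrite -(eqn_pmul2r D_gt0); apply/eqP; rewrite E //.
rewrite -(E _ _ jm im aj ai); last by rewrite addnC.
by rewrite /D [(j + i)%N]addnC -!mulnA [((j - a)`! * _)%N]mulnCA.
Qed.
Variable K : comNzRingType.
Implicit Types p q r s : K.

Definition linf p q : {poly K} := p%:P * 'X + q%:P.

(* With [[p, q], [r, s]] acting on binary forms of degree m by substitution,
   this is the coefficient of X^j Y^(m-j) in the image of X^i Y^(m-i), read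
   off at Y = 1. *)
Definition mcoef (m i j : nat) p q r s : K :=
  (linf p q ^+ i * linf r s ^+ (m - i))`_j.

(** For A of degree at most m: the binary form of degree m that restricts to A at Y = 1, evaluated
    at X = U, Y = V. *)
Definition homog (m : nat) (A U V : {poly K}) : {poly K} :=
  \sum_(j < m.+1) (A`_j)%:P * (U ^+ j * V ^+ (m - j)).

Lemma homog_mul_linf m (A U V : {poly K}) p q : (size A <= m.+1)%N ->
  homog m.+1 (A * linf p q) U V = homog m A U V * (p%:P * U + q%:P * V).
Proof.
move=> sA.
have co j : (A * linf p q)`_j =
    (if j is j'.+1 then A`_j' * p else 0) + A`_j * q.
  rewrite /linf mulrDr mulrA coefD coefMX !coefMC; case: j => //.
rewrite /homog.
under eq_bigr do rewrite co polyCD mulrDl.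
rewrite big_split /= big_ord_recl /= mul0r add0r [X in _ + X]big_ord_recr /=.
rewrite (nth_default _ sA) mul0r polyC0 mul0r addr0 -big_split /= big_distrl /=.
apply: eq_bigr => j _; rewrite /bump /= add1n subSS.
rewrite subSn; last by rewrite -ltnS.
rewrite !polyCM !exprS; ring.
Qed.

Lemma size_linf_expM (A : {poly K}) m p q k : (size A <= m.+1)%N ->
  (size (A * linf p q ^+ k)%R <= (m + k).+1)%N.
Proof.
move=> sA; elim: k => [|k IH]; first by rewrite expr0 mulr1 addn0.
rewrite exprSr mulrA addnS; apply: (leq_trans (size_polyMleq _ _)).
have sl : (size (linf p q) <= 2)%N.
  rewrite /linf; apply: (leq_trans (size_polyD _ _)); rewrite geq_max.
  rewrite (leq_trans (size_polyC_leq1 _)) // andbT.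
  apply: (leq_trans (size_polyMleq _ _)); rewrite size_polyX addn2 /=.
  by rewrite ltnS size_polyC_leq1.
lia.
Qed.

Lemma homog_mul_exp m (A U V : {poly K}) p q k : (size A <= m.+1)%N ->
  homog (m + k) (A * linf p q ^+ k) U V =
  homog m A U V * (p%:P * U + q%:P * V) ^+ k.
Proof.
move=> sA; elim: k => [|k IH]; first by rewrite addn0 !expr0 !mulr1.
rewrite addnS !exprSr !mulrA homog_mul_linf ?IH //.
exact: size_linf_expM.
Qed.

Lemma homog_linf m i (U V : {poly K}) p q r s : (i <= m)%N ->
  homog m (linf p q ^+ i * linf r s ^+ (m - i)) U V =
  (p%:P * U + q%:P * V) ^+ i * (r%:P * U + s%:P * V) ^+ (m - i).
Proof.
move=> im; rewrite -{1}(subnKC im) -[linf p q ^+ i]mul1r.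
have s1 : (size (1%R : {poly K}) <= 1)%N by rewrite size_poly1.
rewrite homog_mul_exp; last by have := @size_linf_expM _ 0 p q i s1.
have := @homog_mul_exp 0 _ U V p q i s1; rewrite add0n => ->.
by rewrite /homog big_ord_recl big_ord0 coef1 /= polyC1 !mulr1 addr0 mul1r.
Qed.

(** Two successive linear substitutions compose to the one given by the matrix product. The left
    side is a coefficient of the i-th image form with the second pair of linear forms substituted
    into it. *)
Lemma mcoefM m i l p q r s p' q' r' s' : (i <= m)%N ->
  \sum_(j < m.+1) mcoef m i j p q r s * mcoef m j l p' q' r' s' =
  mcoef m i l (p * p' + q * r') (p * q' + q * s')
              (r * p' + s * r') (r * q' + s * s').
Proof.
move=> im; transitivity
  (homog m (linf p q ^+ i * linf r s ^+ (m - i)) (linf p' q') (linf r' s'))`_l.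
  by rewrite /homog coef_sum; apply: eq_bigr => j _; rewrite coefCM.
rewrite homog_linf // /mcoef /linf; congr (polyseq (_ ^+ _ * _ ^+ _))`_l;
  by rewrite !polyCD !polyCM; ring.
Qed.

Lemma mcoef_diag m i j p s : (i <= m)%N ->
  mcoef m i j p 0 0 s = (j == i)%:R * (p ^+ i * s ^+ (m - i)).
Proof.
move=> im; rewrite /mcoef /linf polyC0 mul0r add0r addr0 exprMn -!polyC_exp.
by rewrite mulrAC -polyCM coefCM coefXn mulrC.
Qed.

Lemma mcoef_scale_row m i j x y p q r s :
  mcoef m i j (x * p) (x * q) (y * r) (y * s) =
  x ^+ i * y ^+ (m - i) * mcoef m i j p q r s.
Proof.
have E t u v : linf (t * u) (t * v) = t%:P * linf u v.
  by rewrite /linf !polyCM mulrDr mulrA.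
by rewrite /mcoef !E !exprMn mulrACA -!polyC_exp -polyCM coefCM.
Qed.

Lemma mcoef_scale_col m i j x y p q r s : (i <= m)%N -> (j <= m)%N ->
  mcoef m i j (p * x) (q * y) (r * x) (s * y) =
  mcoef m i j p q r s * (x ^+ j * y ^+ (m - j)).
Proof.
move=> im jm; have := @mcoefM m i j p q r s x 0 0 y im.
rewrite !mulr0 !addr0 !add0r => <-.
rewrite (bigD1 (Ordinal (jm : (j < m.+1)%N))) //= mcoef_diag // eqxx mul1r.
rewrite big1 ?addr0 // => t tj; rewrite mcoef_diag; last by rewrite -ltnS.
by rewrite eq_sym (negbTE (tj : (t : nat) != j)) mul0r mulr0.
Qed.

Lemma mcoef_swap_row m i j p q r s : (i <= m)%N ->
  mcoef m (m - i) j p q r s = mcoef m i j r s p q.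
Proof. by move=> im; rewrite /mcoef subKn // mulrC. Qed.

(** Right multiplication by [[0, 1], [1, 0]], whose matrix of entries is the antidiagonal
    permutation. *)
Lemma mcoef_swap_col m i j p q r s : (i <= m)%N -> (j <= m)%N ->
  mcoef m i (m - j) p q r s = mcoef m i j q p s r.
Proof.
move=> im jm; have := @mcoefM m i j p q r s 0 1 1 0 im.
rewrite !mulr0 !mulr1 !addr0 !add0r => <-.
have lt : (m - j < m.+1)%N by rewrite ltnS leq_subr.
have E t : mcoef m t j 0 1 1 0 = (j == m - t)%N%:R.
  by rewrite /mcoef /linf mul0r add0r mul1r addr0 expr1n mul1r coefXn.
rewrite (bigD1 (Ordinal lt)) //= E subKn // eqxx mulr1.
rewrite big1 ?addr0 // => t tj; rewrite E; case: eqP => [jE|]; last first.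
  by rewrite mulr0.
by case/eqP: tj; apply: val_inj => /=; have := ltn_ord t; lia.
Qed.

Lemma coef_linf_exp p q i a :
  (linf p q ^+ i)`_a = 'C(i, a)%:R * (p ^+ a * q ^+ (i - a)).
Proof.
rewrite /linf addrC exprDn coef_sum.
under eq_bigr => t _ do
  rewrite coefMn exprMn -!polyC_exp mulrA -polyCM coefCM coefXn.
have [ai|ia] := leqP a i.
  rewrite (bigD1 (Ordinal (ai : (a < i.+1)%N))) //= eqxx mulr1 big1 ?addr0.
    by rewrite -mulr_natl; ring.
  move=> t; rewrite -val_eqE /= => ta.
  by rewrite eq_sym (negbTE ta) mulr0 mul0rn.
rewrite bin_small // mul0r big1 // => t _.
have -> : (a == t) = false by have := ltn_ord t; lia.
by rewrite mulr0 mul0rn.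
Qed.

Lemma mcoefE m i j p q r s :
  mcoef m i j p q r s = \sum_(a < j.+1) ('C(i, a) * 'C(m - i, j - a))%:R *
    (p ^+ a * q ^+ (i - a) * (r ^+ (j - a) * s ^+ (m - i - (j - a)))).
Proof.
rewrite /mcoef coefM; apply: eq_bigr => a _; rewrite !coef_linf_exp natrM; ring.
Qed.

(** This range of summation is symmetric in i and j, so that [mcoef_tr] can compare the two sums
    term by term. *)
Lemma mcoefE_min m i j p q r s :
  mcoef m i j p q r s =
  \sum_(0 <= a < (minn i j).+1) ('C(i, a) * 'C(m - i, j - a))%:R *
    (p ^+ a * q ^+ (i - a) * (r ^+ (j - a) * s ^+ (m - i - (j - a)))).
Proof.
rewrite mcoefE -(big_mkord xpredT (fun a => ('C(i, a) * 'C(m - i, j - a))%:R *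
    (p ^+ a * q ^+ (i - a) * (r ^+ (j - a) * s ^+ (m - i - (j - a)))))).
have H : ((minn i j).+1 <= j.+1)%N by rewrite ltnS geq_minr.
rewrite (big_cat_nat (leq0n _) H) /=.
rewrite [X in _ + X]big_nat_cond [X in _ + X]big1 ?addr0 // => a.
rewrite andbT => /andP[a1 a2]; rewrite bin_small; first by rewrite mul0n mul0r.
lia.
Qed.

Lemma mcoef_tr m i j p q r s : (i <= m)%N -> (j <= m)%N ->
  'C(m, i)%:R * mcoef m i j p q r s = 'C(m, j)%:R * mcoef m j i p r q s.
Proof.
move=> im jm; rewrite !mcoefE_min [minn j i]minnC !mulr_sumr.
apply: eq_big_nat => a /andP[_ a_le].
rewrite !mulrA -!natrM trinomial_sym //; try lia.
have [/eqP->|h] := boolP ('C(m, j) * ('C(j, a) * 'C(m - j, i - a)) == 0)%N.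
  by rewrite !mul0r.
have -> : (m - i - (j - a) = m - j - (i - a))%N by lia.
ring.
Qed.
End BinaryForms.

(** * Wigner d-functions as normalized entries of real 2 x 2 matrices *)

Section Wigner.
Set Implicit Arguments.
Unset Strict Implicit.
Unset Printing Implicit Defensive.

(* A weight k in [-n, n] labels the monomial X^(n+k) Y^(n-k) of degree 2n. *)
Definition widx (n : nat) (k : int) : nat := absz (n%:Z + k).

Lemma widx_le n k : (`|k| <= n)%N -> (widx n k <= 2 * n)%N.
Proof. rewrite /widx; lia. Qed.

Lemma widxN n k : (`|k| <= n)%N -> widx n (- k) = (2 * n - widx n k)%N.
Proof. rewrite /widx; lia. Qed.

Lemma signr_widx (K : unitRingType) n k l : (`|k| <= n)%N -> (`|l| <= n)%N ->
  (-1) ^+ (widx n k + widx n l) = (-1) ^ (k + l) :> K.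
Proof.
move=> kn ln; have sgz z : (-1) ^ z = (-1) ^+ `|z| :> K.
  case: z => // t; rewrite NegzE -exprnN -[(-1) ^+ `|_|%N]/((-1) ^+ t.+1).
  by rewrite -signr_odd; case: odd; rewrite ?expr0 ?expr1 ?invrN ?invr1.
rewrite sgz -[LHS]signr_odd -[RHS]signr_odd; congr ((-1) ^+ nat_of_bool _).
rewrite /widx; lia.
Qed.

Variable R : realType.
Implicit Types (c s p q r : R) (n : nat) (k l : int).

(* Norm of the monomial of weight k for the inner product that makes the action
   of SU(2) unitary. *)
Definition wnorm n k : R := Num.sqrt ((widx n k)`! * (widx n (- k))`!)%:R.

Lemma wnorm_gt0 n k : 0 < wnorm n k.
Proof. by rewrite sqrtr_gt0 ltr0n muln_gt0 !fact_gt0. Qed.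

Lemma wnormN n k : wnorm n (- k) = wnorm n k.
Proof. by rewrite /wnorm opprK mulnC. Qed.

Definition dcoef n k l p q r s : R :=
  wnorm n l / wnorm n k * mcoef (2 * n) (widx n k) (widx n l) p q r s.

(** The binomial weights of [mcoef_tr] are (2n)! / [wnorm]^2, so the normalization absorbs them
    exactly. *)
Lemma dcoef_tr n k l p q r s : (`|k| <= n)%N -> (`|l| <= n)%N ->
  dcoef n k l p q r s = dcoef n l k p r q s.
Proof.
move=> kn ln; have kn' := widx_le kn; have ln' := widx_le ln.
have E t : (`|t| <= n)%N -> 'C(2 * n, widx n t)%:R =
    (2 * n)`!%:R / wnorm n t ^+ 2.
  move=> tn; rewrite sqr_sqrtr ?ler0n // -(bin_fact (widx_le tn)) -widxN //.
  rewrite natrM mulfK //.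
  by rewrite pnatr_eq0 -lt0n muln_gt0 !fact_gt0.
have := mcoef_tr p q r s kn' ln'; rewrite !E // /dcoef.
move: (mcoef _ _ _ _ _ _ _) (mcoef _ _ _ _ _ _ _) => M M'.
have k0 := lt0r_neq0 (wnorm_gt0 n k); have l0 := lt0r_neq0 (wnorm_gt0 n l).
have f0 : (2 * n)`!%:R != 0 :> R by rewrite pnatr_eq0 -lt0n fact_gt0.
move: (wnorm n k) (wnorm n l) (_%:R) k0 l0 f0 => u v f u0 v0 f0 H.
apply: (mulfI f0); apply: (mulIf (invr_neq0 u0)); apply: (mulIf (invr_neq0 v0)).
transitivity (f / u ^+ 2 * M'); first by field; rewrite u0 v0.
by rewrite H; field; rewrite u0 v0.
Qed.

(** Exchanging X and Y negates every weight and conjugates the matrix by the swap. *)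
Lemma dcoef_flip n k l p q r s : (`|k| <= n)%N -> (`|l| <= n)%N ->
  dcoef n (- k) (- l) p q r s = dcoef n k l s r q p.
Proof.
move=> kn ln; rewrite /dcoef !wnormN !widxN // mcoef_swap_row ?widx_le //.
by rewrite mcoef_swap_col ?widx_le.
Qed.

(** Conjugation by diag(-1, 1). *)
Lemma dcoef_sign n k l p q r s : (`|k| <= n)%N -> (`|l| <= n)%N ->
  dcoef n k l p (- q) (- r) s = (-1) ^ (k + l) * dcoef n k l p q r s.
Proof.
move=> kn ln; rewrite /dcoef mulrCA; congr (_ * _).
have kn' := widx_le kn; have ln' := widx_le ln.
have := mcoef_scale_row (2 * n) (widx n k) (widx n l) (-1) 1 (- p) q (- r) s.
rewrite !mulN1r !mul1r opprK => ->.
have := mcoef_scale_col (-1) 1 p q r s kn' ln'.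
rewrite !mulrN1 !mulr1 => ->.
by rewrite !expr1n -(signr_widx _ kn ln) exprD; ring.
Qed.

(* At c = cos (b/2), s = sin (b/2): the entry of the rotation Ry(b). *)
Definition ycoef n k l c s := dcoef n k l c (- s) s c.

Lemma ycoef_tr n k l c s : (`|k| <= n)%N -> (`|l| <= n)%N ->
  ycoef n l k c s = (-1) ^ (k + l) * ycoef n k l c s.
Proof. by move=> kn ln; rewrite /ycoef dcoef_tr // -dcoef_sign // opprK. Qed.

Lemma ycoef_flip n k l c s : (`|k| <= n)%N -> (`|l| <= n)%N ->
  ycoef n (- k) (- l) c s = (-1) ^ (k + l) * ycoef n k l c s.
Proof. by move=> kn ln; rewrite /ycoef dcoef_flip // -dcoef_sign // opprK. Qed.

Lemma sqr_signz k : ((-1) ^ k) ^+ 2 = 1 :> R.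
Proof.
by rewrite exprnP exprz_exp mulrC -exprz_exp -exprnP sqrrN expr1n exp1rz.
Qed.

(** For k different from l exactly one of the two sides carries the sign of [nu]; for k = l the
    factor is (-1)^(2k) = 1. The rule matches [ycoef_tr]. *)
Lemma wigner_d_tr n k l (x : R) :
  wigner_d n l k x = (-1) ^ (k + l) * wigner_d n k l x.
Proof.
rewrite /wigner_d -[l - k]opprB abszN [l + k]addrC [maxn `|l| _]maxnC.
rewrite -!mulrA [RHS]mulrA.
congr (_ * _); case: ltgtP => [kl|lk|->].
- by rewrite expr0z mulr1.
- by rewrite -expr2 sqr_signz expr0z.
- by rewrite expr0z mulr1 exprzDr ?unitrN1 // -expr2 sqr_signz.
Qed.

Lemma wigner_d_flip n k l (x : R) :
  wigner_d n (- k) (- l) x = (-1) ^ (k + l) * wigner_d n k l x.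
Proof.
rewrite -wigner_d_tr /wigner_d ltrN2 -!opprD !abszN -[l - k]opprB abszN.
rewrite [l + k]addrC [maxn `|l| _]maxnC -!mulrA; congr (_ * _).
have H : (-1) ^ (-1) = -1 :> R by rewrite -[LHS]/(- 1)^-1 invrN invr1.
by case: ifP => // _; rewrite -[- (k + l)]mulN1r -exprz_exp H.
Qed.

Lemma jacobi_mcoef m i j c s : (i <= j)%N -> (j <= m)%N -> (m <= i + j)%N ->
  c ^+ 2 + s ^+ 2 = 1 ->
  s ^+ (j - i) * c ^+ (i + j - m) *
    jacobi (m - j) (j - i) (i + j - m) (c ^+ 2 - s ^+ 2) =
  mcoef m i j c (- s) s c.
Proof.
move=> ij jm mij cs1; have im := leq_trans ij jm.
(* Negating both weights gives a binomial sum with m - j + 1 terms, as many as in the Jacobi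
   polynomial; the two sums then agree after reversing the index. *)
have -> : mcoef m i j c (- s) s c = mcoef m (m - i) (m - j) c s (- s) c.
  by rewrite mcoef_swap_row // mcoef_swap_col.
rewrite mcoefE (reindex_inj rev_ord_inj) /= /jacobi mulr_sumr.
apply: eq_bigr => -[t /=]; rewrite ltnS => tS _; rewrite subSS.
have -> : (c ^+ 2 - s ^+ 2 - 1) / 2 = - s * s
  by rewrite -[X in _ - X]cs1; field.
have -> : (c ^+ 2 - s ^+ 2 + 1) / 2 = c * c by rewrite -[X in _ + X]cs1; field.
have -> : (m - (m - i) = i)%N by lia.
have -> : (m - j - (m - j - t) = t)%N by lia.
have -> : (m - j + (j - i) = m - i)%N by lia.
have -> : (m - j + (i + j - m) = i)%N by lia.
have -> : (m - i - (m - j - t) = j - i + t)%N by lia.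
have -> : (i - t = i + j - m + (m - j - t))%N by lia.
rewrite !exprMn !exprD natrM; ring.
Qed.

(* For |l| <= k the sign (-1)^nu of wigner_d n l k is 1. *)
Lemma wigner_d_core n k l c s : (`|l| <= k)%R -> (`|k| <= n)%N ->
  0 <= c -> 0 <= s -> c ^+ 2 + s ^+ 2 = 1 ->
  wigner_d n l k (c ^+ 2 - s ^+ 2) = ycoef n l k c s.
Proof.
move=> lk kn c0 s0 cs1; have ln : (`|l| <= n)%N by lia.
have half (u : R) a : 0 <= u -> (u ^+ 2) `^ (a%:R / 2) = u ^+ a.
  move=> u0; rewrite -powR_mulrn // -powRrM -powR_mulrn //.
  by congr (_ `^ _); field.
have Ei := widx_le kn.
have jk : (widx n l <= widx n k)%N by rewrite /widx; lia.
have mij : (2 * n <= widx n l + widx n k)%N by rewrite /widx; lia.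
rewrite /ycoef /dcoef -jacobi_mcoef //.
rewrite /wigner_d.
have -> : (k < l) = false by lia.
have -> : absz (l - k) = (widx n k - widx n l)%N by rewrite /widx; lia.
have -> : absz (l + k) = (widx n l + widx n k - 2 * n)%N by rewrite /widx; lia.
have -> : (n - maxn `|l| `|k|)%N = (2 * n - widx n k)%N by rewrite /widx; lia.
have -> : (1 - (c ^+ 2 - s ^+ 2)) / 2 = s ^+ 2
  by rewrite -[X in X - _]cs1; field.
have -> : (1 + (c ^+ 2 - s ^+ 2)) / 2 = c ^+ 2
  by rewrite -[X in X + _]cs1; field.
rewrite !half // expr0z mul1r !mulrA; congr (_ * _ * _ * _).
(* The powers and the Jacobi factor agree; what remains is that the quotient of the two binomials is
   the squared ratio of the norms. *)
rewrite /wnorm !widxN //.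
move: (widx n l) (widx n k) (2 * n)%N Ei jk mij => i j m jm ij mij.
rewrite -!sqrtrV ?ler0n // -!sqrtrM ?ler0n //; congr Num.sqrt.
have fne t : t`!%:R != 0 :> R by rewrite pnatr_eq0 -lt0n fact_gt0.
have b1 : (m - i <= j)%N by lia.
have b2 : (i + j - m <= i)%N by lia.
have -> : (m - (m - j) = j)%N by lia.
have -> : (m - j + (j - i) = m - i)%N by lia.
have -> : (m - j + (i + j - m) = i)%N by lia.
rewrite -(bin_fact b1) -(bin_fact b2).
have -> : (j - (m - i) = i + j - m)%N by lia.
have -> : (i - (i + j - m) = m - j)%N by lia.
rewrite !natrM; field.
by rewrite !fne pnatr_eq0 -lt0n bin_gt0 b2.
Qed.

(** Both sides obey the same sign rules under transposition and under negating both weights, and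
    these moves bring any pair of weights into the range of [wigner_d_core]. *)
Lemma wigner_dE n k l c s : (`|k| <= n)%N -> (`|l| <= n)%N ->
  0 <= c -> 0 <= s -> c ^+ 2 + s ^+ 2 = 1 ->
  wigner_d n k l (c ^+ 2 - s ^+ 2) = ycoef n k l c s.
Proof.
move=> + + c0 s0 cs1.
have key k' l' : (`|k'| <= `|l'|)%N -> (`|k'| <= n)%N -> (`|l'| <= n)%N ->
    wigner_d n k' l' (c ^+ 2 - s ^+ 2) = ycoef n k' l' c s.
  move=> kl kn ln; have [l0|l0] := leP 0 l'.
    by apply: wigner_d_core => //; lia.
  rewrite -[k']opprK -[l']opprK wigner_d_flip ycoef_flip ?abszN //.
  congr (_ * _).
  by apply: wigner_d_core => //; rewrite ?abszN //; lia.
have [kl|lk] := leqP `|k| `|l| => kn ln; first exact: key.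
by rewrite wigner_d_tr ycoef_tr // key // ltnW.
Qed.
End Wigner.

(** * Fourier expansion in beta, and independence of the choice of Euler angles *)

Section Euler.
Set Implicit Arguments.
Unset Strict Implicit.
Unset Printing Implicit Defensive.
Variable R : realType.
Local Notation C := R[i].
Implicit Types (n : nat) (k l : int) (a b c h : R) (x y : R * R * R).

Lemma mcoef_rmorph (K L : comNzRingType) (f : {rmorphism K -> L})
    m i j (p q r s : K) :
  f (mcoef m i j p q r s) = mcoef m i j (f p) (f q) (f r) (f s).
Proof.
have E u v : map_poly f (linf u v) = linf (f u) (f v).
  by rewrite /linf rmorphD rmorphM /= !map_polyC map_polyX.
by rewrite /mcoef -coef_map rmorphM !rmorphXn /= !E.
Qed.

Lemma expiD a b : expi (a + b) = expi a * expi b.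
Proof. by rewrite /expi cosD sinD; simpc; rewrite [cos a * sin b + _]addrC. Qed.

Lemma expi0 : expi 0 = 1 :> C.
Proof. by rewrite /expi cos0 sin0. Qed.

Lemma expiX a n : expi a ^+ n = expi (n%:R * a).
Proof.
elim: n => [|n IH]; first by rewrite expr0 mul0r expi0.
by rewrite exprS IH -expiD; congr expi; rewrite -natr1; ring.
Qed.

Lemma conjc_expi a : conjc (expi a) = expi (- a).
Proof. by rewrite /expi cosN sinN. Qed.

(** The action of diag(e^{ia}, e^{-ia}) on the monomial of weight k: the exponents n + k and n - k
    differ by 2k. *)
Lemma expi_widx n k a : (`|k| <= n)%N ->
  expi a ^+ widx n k * expi (- a) ^+ (2 * n - widx n k) =
  expi (k%:~R * (a *+ 2)).
Proof.
move=> kn; rewrite -widxN // !expiX -expiD; congr expi.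
have E (t : int) : (`|t| <= n)%N -> (widx n t)%:R = n%:R + t%:~R :> R.
  move=> tn; rewrite -[_%:R]/((widx n t)%:Z%:~R) -[n%:R]/(n%:Z%:~R) -intrD.
  by congr _%:~R; rewrite /widx; lia.
by rewrite !E ?abszN // intrN; ring.
Qed.

Definition dcoefC n k l (p q r s : C) : C :=
  (wnorm R n l / wnorm R n k)%:C%C *
  mcoef (2 * n) (widx n k) (widx n l) p q r s.

Lemma dcoefC_real n k l (p q r s : R) :
  (dcoef n k l p q r s)%:C%C = dcoefC n k l p%:C%C q%:C%C r%:C%C s%:C%C.
Proof. by rewrite /dcoef rmorphM /= (mcoef_rmorph (real_complex R)). Qed.

Lemma dcoefC_scale_row n k l (x y p q r s : C) :
  dcoefC n k l (x * p) (x * q) (y * r) (y * s) =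
  x ^+ widx n k * y ^+ (2 * n - widx n k) * dcoefC n k l p q r s.
Proof. by rewrite /dcoefC mcoef_scale_row; ring. Qed.

Lemma dcoefC_scale_col n k l (x y p q r s : C) :
  (`|k| <= n)%N -> (`|l| <= n)%N ->
  dcoefC n k l (p * x) (q * y) (r * x) (s * y) =
  dcoefC n k l p q r s * (x ^+ widx n l * y ^+ (2 * n - widx n l)).
Proof.
by move=> kn ln; rewrite /dcoefC mcoef_scale_col ?widx_le //; exact: mulrA.
Qed.

Lemma widx_ord n (j : 'I_(2 * n).+1) : widx n (j%:Z - n%:Z) = j.
Proof. by rewrite /widx; lia. Qed.

Lemma abs_ord n (j : 'I_(2 * n).+1) : (`|(j%:Z - n%:Z)%R| <= n)%N.
Proof. by have := ltn_ord j; lia. Qed.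

(** The norm ratios telescope through the intermediate weight j - n, so the normalized entries still
    multiply as matrices. *)
Lemma dcoefCM n k l (p q r s p' q' r' s' : C) : (`|k| <= n)%N ->
  \sum_(j < (2 * n).+1) dcoefC n k (j%:Z - n%:Z) p q r s *
                        dcoefC n (j%:Z - n%:Z) l p' q' r' s' =
  dcoefC n k l (p * p' + q * r') (p * q' + q * s')
               (r * p' + s * r') (r * q' + s * s').
Proof.
move=> kn; rewrite /dcoefC -mcoefM ?widx_le // mulr_sumr.
apply: eq_bigr => j _; rewrite widx_ord.
have -> : wnorm R n l / wnorm R n k =
    wnorm R n (j%:Z - n%:Z) / wnorm R n k *
    (wnorm R n l / wnorm R n (j%:Z - n%:Z)).
  by field; rewrite !lt0r_neq0 ?wnorm_gt0.
rewrite rmorphM /=; ring.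
Qed.

(** Swapping the columns of [[h, -h], [h, h]] has the same effect as negating its first row. *)
Lemma ycoef_opp n k l h : (`|k| <= n)%N -> (`|l| <= n)%N ->
  ycoef n k (- l) h h = (-1) ^+ widx n k * ycoef n k l h h.
Proof.
move=> kn ln; rewrite /ycoef /dcoef wnormN mulrCA; congr (_ * _).
rewrite widxN // mcoef_swap_col ?widx_le //.
have := mcoef_scale_row (2 * n) (widx n k) (widx n l) (-1) 1 h (- h) h h.
by rewrite !mulN1r !mul1r opprK expr1n mulr1 => ->.
Qed.

(* [[c, -s], [s, c]] = A diag(w, w') A^-1 where A = h [[1, 1], [-i, i]] and
   w, w' = c +- i s. *)
Lemma half_rotation (K : comNzRingType) (i h c s w w' : K) :
  i * i = -1 -> h * h *+ 2 = 1 -> w = c + i * s -> w' = c - i * s ->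
  [/\ h * w * h + h * w' * h = c,
      h * w * (i * h) + h * w' * (- i * h) = - s,
      - i * h * w * h + i * h * w' * h = s &
      - i * h * w * (i * h) + i * h * w' * (- i * h) = c].
Proof.
move=> ii hh -> ->; split.
- by rewrite -[RHS]mul1r -hh; ring.
- transitivity (i * i * (h * h *+ 2) * s); first by ring.
  by rewrite ii hh; ring.
- transitivity (- (i * i) * (h * h *+ 2) * s); first by ring.
  by rewrite ii hh; ring.
- transitivity (- (i * i) * (h * h *+ 2) * c); first by ring.
  by rewrite ii hh; ring.
Qed.

(** This is [half_rotation] read in degree 2n. On weight t the diagonal factor acts by e^{i t b};
    the outer factors are, up to diagonal matrices, the matrix [[h, -h], [h, h]] and its transpose,
    which yields the entries at [h] and the power of i. *)
Lemma ycoef_fourier n k l b h :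
  (`|k| <= n)%N -> (`|l| <= n)%N -> 2 * h ^+ 2 = 1 ->
  (ycoef n k l (cos (b / 2)) (sin (b / 2)))%:C%C =
  ('i%C : C) ^ (l - k) * \sum_(j < (2 * n).+1)
    (ycoef n (j%:Z - n%:Z) (- k) h h * ycoef n (j%:Z - n%:Z) (- l) h h)%:C%C *
    expi ((j%:Z - n%:Z)%:~R * b).
Proof.
move=> kn ln h2; set i : C := 'i%C.
have ii : i * i = -1 by rewrite -expr2 sqr_i.
have i0 : i != 0.
  apply/eqP => i0; move/eqP: ii.
  by rewrite i0 mul0r eq_sym oppr_eq0 oner_eq0.
have hh : h%:C%C * h%:C%C *+ 2 = 1 :> C.
  by rewrite -rmorphM -rmorphMn /= -mulr_natl -expr2 h2.
have wE : expi (b / 2) = (cos (b / 2))%:C%C + i * (sin (b / 2))%:C%C.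
  by rewrite /i /expi; simpc.
have wE' : expi (- (b / 2)) = (cos (b / 2))%:C%C - i * (sin (b / 2))%:C%C.
  by rewrite /i /expi cosN sinN; simpc.
set w := expi _ in wE; set w' := expi _ in wE'.
set H : C := h%:C%C.
rewrite [in LHS]/ycoef dcoefC_real.
transitivity (dcoefC n k l
   (H * w * H + H * w' * H) (H * w * (i * H) + H * w' * (- i * H))
   (- i * H * w * H + i * H * w' * H)
   (- i * H * w * (i * H) + i * H * w' * (- i * H))).
  rewrite rmorphN; have [<- <- <- <-] // := half_rotation ii hh wE wE'.
rewrite -dcoefCM // mulr_sumr; apply: eq_bigr => j _.
have jn := abs_ord j; set t := j%:Z - n%:Z in jn *.
have -> : expi (t%:~R * b) = w ^+ widx n t * w' ^+ (2 * n - widx n t).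
  by rewrite expi_widx //; congr expi; field.
(* This is A diag(w, w') with A = diag(1, i) [[h, h], [-h, h]]; transposing the last matrix turns
   its entry into [ycoef n t k h h]. *)
have -> : dcoefC n k t (H * w) (H * w') (- i * H * w) (i * H * w') =
    i ^+ (2 * n - widx n k) * (ycoef n t k h h)%:C%C *
    (w ^+ widx n t * w' ^+ (2 * n - widx n t)).
  rewrite dcoefC_scale_col //; congr (_ * _).
  have := dcoefC_scale_row n k t 1 i H H (- H) H.
  rewrite !mul1r mulrN -mulNr expr1n mul1r => ->; congr (_ * _).
  by rewrite /ycoef dcoef_tr // dcoefC_real rmorphN.
(* Here A^-1 = [[h, -h], [h, h]] diag(1, -i). *)
have -> : dcoefC n t l H (i * H) H (- i * H) =
    (- i) ^+ (2 * n - widx n l) * (ycoef n t l h h)%:C%C.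
  transitivity (dcoefC n t l (H * 1) (- H * - i) (H * 1) (H * - i)).
    by rewrite !mulr1 mulrNN mulrN mulNr [H * i]mulrC.
  by rewrite dcoefC_scale_col // expr1n mul1r mulrC /ycoef dcoefC_real rmorphN.
have -> : i ^ (l - k) = i ^+ (2 * n - widx n k) * (- i) ^+ (2 * n - widx n l).
  rewrite -!widxN //; have -> : - i = i^-1.
    by apply: (mulfI i0); rewrite mulrN ii opprK mulfV.
  rewrite exprVn exprnN exprnP -expfzDr //; congr (_ ^ _); rewrite /widx; lia.
(* Passing from - k, - l to k, l costs the sign (-1)^(n + t) twice, hence nothing. *)
rewrite !ycoef_opp //.
have -> : (-1) ^+ widx n t * ycoef n t k h h *
    ((-1) ^+ widx n t * ycoef n t l h h) =
  ycoef n t k h h * ycoef n t l h h.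
  by rewrite mulrACA -expr2 sqrr_sign mul1r.
rewrite (rmorphM (real_complex R) (ycoef n t k h h)) /=.
by move: (_%:C%C) (_%:C%C) (_ ^+ _) (_ ^+ _) => *; ring.
Qed.

(* Cayley-Klein parameters: [[ck1, ck2], [- ck2^*, ck1^*]] in SU(2) covers the
   rotation with Euler angles x. *)
Definition ck1 x : C :=
  expi (- (x.1.1 / 2)) * ((cos (x.1.2 / 2))%:C%C * expi (- (x.2 / 2))).
Definition ck2 x : C :=
  expi (- (x.1.1 / 2)) * (- (sin (x.1.2 / 2))%:C%C * expi (x.2 / 2)).

Definition euler_coef n k l x : C :=
  dcoefC n k l (ck1 x) (ck2 x) (- conjc (ck2 x)) (conjc (ck1 x)).

(** The SU(2) matrix is the real half-angle rotation between two diagonal matrices, which contribute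
    the phases in alpha and gamma. *)
Lemma euler_coefE n k l x : (`|k| <= n)%N -> (`|l| <= n)%N ->
  euler_coef n k l x = expi (- (k%:~R * x.1.1)) *
    (ycoef n k l (cos (x.1.2 / 2)) (sin (x.1.2 / 2)))%:C%C *
    expi (- (l%:~R * x.2)).
Proof.
move=> kn ln; rewrite /euler_coef /ck1 /ck2.
have conjM (u v : C) : conjc (u * v) = conjc u * conjc v by exact: rmorphM.
have conjN (u : C) : conjc (- u) = - conjc u by exact: rmorphN.
rewrite !conjM conjN !conjc_real !conjc_expi !opprK.
have -> (u v w : C) : - (u * (- v * w)) = u * (v * w) by ring.
rewrite dcoefC_scale_row dcoefC_scale_col //.
have E (z : int) a : (`|z| <= n)%N ->
    expi (- (a / 2)) ^+ widx n z * expi (a / 2) ^+ (2 * n - widx n z) =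
    expi (- (z%:~R * a)).
  by move=> zn; rewrite -{2}[a / 2]opprK expi_widx //; congr expi; field.
by rewrite !E // /ycoef dcoefC_real rmorphN mulrA.
Qed.

Ltac rot_entry := rewrite /Rot !mxE !big_ord_recr big_ord0 /= !mxE
  !big_ord_recr !big_ord0 /= !mxE /=; ring.

Lemma Rot00 a b c : Rot a b c 0 0 = cos a * cos b * cos c - sin a * sin c.
Proof. rot_entry. Qed.
Lemma Rot01 a b c : Rot a b c 0 1 = - (cos a * cos b * sin c) - sin a * cos c.
Proof. rot_entry. Qed.
Lemma Rot02 a b c : Rot a b c 0 2 = cos a * sin b.
Proof. rot_entry. Qed.
Lemma Rot10 a b c : Rot a b c 1 0 = sin a * cos b * cos c + cos a * sin c.
Proof. rot_entry. Qed.
Lemma Rot11 a b c : Rot a b c 1 1 = - (sin a * cos b * sin c) + cos a * cos c.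
Proof. rot_entry. Qed.
Lemma Rot12 a b c : Rot a b c 1 2 = sin a * sin b.
Proof. rot_entry. Qed.

Lemma cos_half b : cos b = cos (b / 2) ^+ 2 - sin (b / 2) ^+ 2.
Proof.
have {1}-> : b = (b / 2) *+ 2 by field.
by rewrite cos_mulr2n sin2cos2; ring.
Qed.

Lemma sin_half b : sin b = 2 * (cos (b / 2) * sin (b / 2)).
Proof.
have {1}-> : b = (b / 2) *+ 2 by field.
by rewrite sin_mulr2n mulr_natl.
Qed.

Lemma expi_sqr a : expi a ^+ 2 = expi (a *+ 2).
Proof. by rewrite expiX mulr_natl. Qed.

Lemma complex_ext (u v u' v' : R) :
  u = u' -> v = v' -> (u +i* v)%C = (u' +i* v')%C.
Proof. by move=> -> ->. Qed.

Let M x := Rot x.1.1 x.1.2 x.2.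

(** Together with the next two formulas: the rotation matrix determines the squares and the product
    of the Cayley-Klein parameters, hence the pair up to a common sign. *)
Lemma ck1_sqr x :
  ck1 x ^+ 2 = (((M x 0 0 + M x 1 1) / 2) -i* ((M x 1 0 - M x 0 1) / 2))%C.
Proof.
case: x => [[a b] c]; rewrite /M /ck1 /= Rot00 Rot11 Rot10 Rot01.
rewrite !exprMn !expi_sqr -rmorphXn /=.
have -> : cos (b / 2) ^+ 2 = (1 + cos b) / 2.
  by rewrite [cos b]cos_half sin2cos2; field.
have -> : - (a / 2) *+ 2 = - a by field.
have -> : - (c / 2) *+ 2 = - c by field.
rewrite /expi !cosN !sinN; simpc.
by apply: complex_ext; field.
Qed.

Lemma ck2_sqr x :
  ck2 x ^+ 2 = (((M x 1 1 - M x 0 0) / 2) +i* ((M x 0 1 + M x 1 0) / 2))%C.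
Proof.
case: x => [[a b] c]; rewrite /M /ck2 /= Rot00 Rot11 Rot10 Rot01.
rewrite !exprMn sqrrN !expi_sqr -rmorphXn /=.
have -> : sin (b / 2) ^+ 2 = (1 - cos b) / 2.
  by rewrite [cos b]cos_half sin2cos2; field.
have -> : - (a / 2) *+ 2 = - a by field.
have -> : (c / 2) *+ 2 = c by field.
rewrite /expi !cosN !sinN; simpc.
by apply: complex_ext; field.
Qed.

Lemma ck1_ck2 x : ck1 x * ck2 x = ((- M x 0 2 / 2) +i* (M x 1 2 / 2))%C.
Proof.
case: x => [[a b] c]; rewrite /M /ck1 /ck2 /= Rot02 Rot12.
transitivity (- ((cos (b / 2))%:C%C * (sin (b / 2))%:C%C) *
  expi (- (a / 2)) ^+ 2 *
  (expi (- (c / 2)) * expi (c / 2))); first by ring.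
rewrite -expiD addNr expi0 mulr1 expi_sqr [sin b]sin_half.
have -> : - (a / 2) *+ 2 = - a by field.
by rewrite /expi !cosN !sinN; simpc; apply: complex_ext; field.
Qed.

Lemma euler_coef_phi n k l x y : (`|k| <= n)%N -> (`|l| <= n)%N ->
  phi x = phi y -> euler_coef n k l x = euler_coef n k l y.
Proof.
move=> kn ln /(congr1 val) Exy.
have {Exy} E : M x = M y by case: x y Exy => [[? ?] ?] [[? ?] ?].
have E1 : ck1 x ^+ 2 = ck1 y ^+ 2 by rewrite !ck1_sqr E.
have E2 : ck2 x ^+ 2 = ck2 y ^+ 2 by rewrite !ck2_sqr E.
have E12 : ck1 x * ck2 x = ck1 y * ck2 y by rewrite !ck1_ck2 E.
(* SU(2) -> SO(3) is two-to-one, and forms of even degree 2n are blind to the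
   sign. *)
suff : (ck1 x = ck1 y /\ ck2 x = ck2 y) \/
    (ck1 x = - ck1 y /\ ck2 x = - ck2 y).
  rewrite /euler_coef => -[[-> ->] //|[-> ->]].
  have conjN (u : C) : conjc (- u) = - conjc u by exact: rmorphN.
  have := dcoefC_scale_row n k l (-1) (-1) (ck1 y) (ck2 y)
    (- conjc (ck2 y)) (conjc (ck1 y)).
  rewrite !mulN1r !conjN => ->.
  by rewrite -exprD subnKC ?widx_le // exprM sqrrN !expr1n mul1r.
(* The squares fix each parameter up to its own sign. The product ties the two signs together,
   unless [ck1 y] vanishes and only the sign of [ck2] is left. *)
have [y0|y0] := eqVneq (ck1 y) 0.
  have x0 : ck1 x = 0 by move/eqP: E1; rewrite y0 expr0n /= expf_eq0 => /eqP.
  rewrite x0 y0 oppr0; move/eqP: E2.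
  by rewrite eqf_sqr => /orP[]/eqP->; [left|right].
move/eqP: E1; rewrite eqf_sqr => /orP[]/eqP H; [left|right]; split=> //;
  apply: (mulfI y0); first by rewrite -E12 H.
by rewrite mulrN -E12 H mulNr opprK.
Qed.

Lemma phi_beta x : exists y, 0 <= y.1.2 <= pi /\ phi y = phi x.
Proof.
case: x => [[a b] c].
have cb : -1 <= cos b <= 1 by rewrite cos_geN1 cos_le1.
have b'P : 0 <= acos (cos b) <= pi by rewrite acos_ge0 ?acos_lepi.
have cE : cos (acos (cos b)) = cos b by rewrite acosK // in_itv.
have sE : sin (acos (cos b)) = `|sin b|.
  by rewrite sin_acos // -sin2cos2 sqrtr_sqr.
have [s0|s0] := leP 0 (sin b).
  exists (a, acos (cos b), c); split=> //; apply: val_inj => /=.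
  by rewrite /Rot /Ry cE sE ger0_norm.
(* The new middle angle is - b modulo 2 pi, and Rz(pi) Ry(- b) Rz(pi) = Ry(b). *)
exists (a + pi, acos (cos b), c + pi); split=> //; apply: val_inj => /=.
rewrite /Rot /Ry /Rz cE sE ltr0_norm // !cosDpi !sinDpi.
apply/matrixP => i j; do 2 rewrite !mxE !big_ord_recr !big_ord0 /=.
rewrite !mxE.
by case: i => [[|[|[|//]]] ?]; case: j => [[|[|[|//]]] ?] /=; ring.
Qed.

(** [wigner_D] is computed at chosen angles with beta in [0, pi], where the half-angle cosine and
    sine are nonnegative and [wigner_dE] applies; [euler_coef_phi] then transports the value to an
    arbitrary x. *)
Lemma wigner_D_phi n k l x : (`|k| <= n)%N -> (`|l| <= n)%N ->
  wigner_D (n, k, l) (phi x) =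
    (Num.sqrt (2 * n + 1)%:R)%:C%C * euler_coef n k l x.
Proof.
move=> kn ln; rewrite /wigner_D.
have : 0 <= (euler_angles (phi x)).1.2 <= pi /\
    phi (euler_angles (phi x)) = phi x.
  (* The default value of [xget] is ruled out by [phi_beta]. *)
  rewrite /euler_angles; case: xgetP => [y _ //|]; have [y Hy] := phi_beta x.
  by move=> /(_ y) /(_ Hy).
case: (euler_angles _) => [[a b] c] [/= /andP[b0 bpi] E].
rewrite -(@euler_coef_phi n k l (a, b, c) x kn ln E) euler_coefE //= -!mulrA.
congr (_ * (_ * (_%:C%C * _))).
rewrite [cos b]cos_half wigner_dE //.
- by apply: cos_ge0_pihalf; apply/andP; split; lra.
- by apply: sin_ge0_pi; apply/andP; split; lra.
- exact: cos2Dsin2.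
Qed.

End Euler.

(** * Assembling the matrix of the DFS operator from finite sums *)

Section DoubleFourierSphere.
Set Implicit Arguments.
Unset Strict Implicit.
Unset Printing Implicit Defensive.

Lemma fsumr_image_seq (V : nmodType) (I K : choiceType) (r : seq I) (h : I -> K)
    (A : set K) (F : K -> V) :
  uniq r -> injective h -> (forall i, i \in r -> A (h i)) ->
  (forall j, A j -> F j != 0 -> exists2 i, i \in r & h i = j) ->
  \sum_(j \in A) F j = \sum_(i <- r) F (h i).
Proof.
move=> ur hI rA FA; rewrite -(big_map h xpredT F).
rewrite [RHS]fsbig_seq ?(map_inj_uniq hI) //.
apply: esym; apply: fsbig_widen => [j /= /mapP[i ir ->]|j [/= Aj nj]].
  exact: rA.
apply/eqP; apply: contra_notT nj => /(FA _ Aj)[i ir <-].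
by apply/mapP; exists i.
Qed.

Variable R : realType.
Local Notation C := R[i].
Implicit Types (n N : nat) (k l j : int) (x : R * R * R) (p : nat * int * int)
  (m : int * int * int).

Lemma finite_int_ball N : finite_set [set k : int | (`|k| <= N)%N].
Proof.
apply: (@sub_finite_set _ _ ((fun i : nat => i%:Z - N%:Z) @` `I_(2 * N).+1)).
  by move=> k /= kN; exists (widx N k); rewrite /widx; lia.
exact/finite_image/finite_II.
Qed.

Lemma finite_box N : finite_set (box N).
Proof.
have fN := finite_int_ball N.
apply: sub_finite_set (finite_setX (finite_setX fN fN) fN).
by move=> [[k j] l] [].
Qed.

Lemma finite_J N : finite_set (J N).
Proof.
have fN := finite_int_ball N.
apply: sub_finite_set (finite_setX (finite_setX (finite_II N.+1) fN) fN).
by move=> [[n k] l] [[/= kn ln] nN]; split; [split|] => //=; lia.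
Qed.

(** The argument 0 is cos(pi/2), and at the half-angle pi/4 cosine and sine coincide. *)
Lemma wigner_d0 n k l (h : R) : (`|k| <= n)%N -> (`|l| <= n)%N -> 0 <= h ->
  2 * h ^+ 2 = 1 -> wigner_d n k l 0 = ycoef n k l h h.
Proof.
move=> kn ln h0 h2; rewrite -wigner_dE //; first by rewrite subrr.
by rewrite -mulr2n -mulr_natl.
Qed.

(** The matrix entry in row m and column p, that is, the Fourier coefficient at m of the lifted
    function [wigner_D p]. The weights are negated because D carries the phases e^{-ik alpha} and
    e^{-il gamma}. *)
Definition Wentry p m : C :=
  if [&& p.1.2 == - m.1.1, p.2 == - m.2 & (`|m.1.2| <= p.1.1)%N] then
    ('i%C : C) ^ (m.1.1 - m.2) *
    (Num.sqrt (2 * p.1.1 + 1)%:R * wigner_d p.1.1 m.1.2 m.1.1 0 *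
     wigner_d p.1.1 m.1.2 m.2 0)%:C%C
  else 0.

Lemma Wmx_sum N (fh : nat * int * int -> C) m :
  Wmx N fh m = \sum_(p \in J N) fh p * Wentry p m.
Proof.
case: m => [[k j] l]; rewrite /Wmx mulr_sumr.
rewrite (@fsumr_image_seq _ _ _ (index_iota (maxn (maxn `|k| `|l|) `|j|) N.+1)
  (fun n => (n, - k, - l))) ?iota_uniq //.
- apply: eq_big_nat => n /andP[n1 n2]; rewrite /Wentry /= !eqxx /=.
  by rewrite (leq_trans (leq_maxr _ _) n1); ring.
- by move=> n n' [].
- by move=> n; rewrite mem_index_iota => nI; split; [split|] => /=; lia.
- move=> [[n k'] l'] [[/= kn ln] nN]; rewrite /Wentry /=.
  case: ifP => [/and3P[/eqP kE /eqP lE jn]|]; last by rewrite mulr0 eqxx.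
  by exists n; rewrite ?kE ?lE // mem_index_iota; lia.
Qed.

Lemma wigner_D_fourier N p x : J N p ->
  wigner_D p (phi x) = \sum_(m \in box N) Wentry p m * torus_exp m x.
Proof.
case: p => [[n k] l] [[kn ln] nN]; rewrite /= in kn ln nN.
rewrite wigner_D_phi // euler_coefE //.
rewrite (@fsumr_image_seq _ _ _ (enum 'I_(2 * n).+1)
  (fun j : 'I_(2 * n).+1 => (- k, j%:Z - n%:Z, - l))) ?enum_uniq //.
- pose h : R := Num.sqrt (2^-1).
  have h0 : 0 <= h by exact: sqrtr_ge0.
  have h2 : 2 * h ^+ 2 = 1.
    by rewrite sqr_sqrtr ?invr_ge0 ?ler0n // divff // pnatr_eq0.
  rewrite (ycoef_fourier _ kn ln h2) !mulr_sumr mulr_suml mulr_sumr big_enum /=.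
  apply: eq_bigr => j _; have jn := abs_ord j.
  rewrite /Wentry /= !opprK !eqxx jn /= !(wigner_d0 _ _ h0 h2) ?abszN //.
  have -> : - k + l = l - k by rewrite addrC.
  rewrite -[Num.sqrt _ * _ * _]mulrA.
  rewrite (rmorphM (real_complex R) (Num.sqrt _)) /=.
  have -> : torus_exp (- k, j%:Z - n%:Z, - l) x =
      expi (- (k%:~R * x.1.1)) * expi ((j%:Z - n%:Z)%:~R * x.1.2) *
      expi (- (l%:~R * x.2)).
    by rewrite /torus_exp /= -!expiD !intrN; congr expi; ring.
  by move: (expi _) (expi _) (expi _) (_%:C%C) (_%:C%C) (_ ^ _) => *; ring.
- by move=> j j' [] jj; apply: val_inj => /=; lia.
- by move=> j _; have := abs_ord j; split=> /=; lia.
- move=> [[k' j] l'] [/= k'N jN l'N]; rewrite /Wentry /=.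
  case: ifP => [/and3P[/eqP kE /eqP lE jn]|]; last by rewrite mul0r eqxx.
  have jlt : (widx n j < (2 * n).+1)%N by rewrite ltnS widx_le.
  exists (Ordinal jlt); first by rewrite mem_enum.
  by rewrite kE lE !opprK /=; congr (_, _, _); rewrite /widx; lia.
Qed.

Lemma FSO3_phi N fh x : ell (J N) fh ->
  FSO3 fh (phi x) = \sum_(m \in box N) Wmx N fh m * torus_exp m x.
Proof.
move=> fhJ; rewrite /FSO3 -(fsbig_widen (J N)); first last.
- by move=> p [_ /= Jp]; rewrite /= fhJ // mul0r.
- by move=> p [].
transitivity (\sum_(p \in J N) \sum_(m \in box N)
    fh p * (Wentry p m * torus_exp m x)).
  apply: eq_fsbigr => p /set_mem Jp.
  by rewrite (wigner_D_fourier _ Jp) mulr_fsumr.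
rewrite exchange_fsbig; [|exact: finite_J|exact: finite_box].
apply: eq_fsbigr => m _; rewrite Wmx_sum mulr_fsuml.
by apply: eq_fsbigr => p _; rewrite mulrA.
Qed.

Lemma Wmx_outside N fh m : ~ box N m -> Wmx (R := R) N fh m = 0.
Proof.
case: m => [[k j] l] mN; rewrite /Wmx big_geq ?mulr0 // leqNgt.
by apply/negP => h; apply: mN; split=> /=; lia.
Qed.

(** This makes the pseudo-inverse [FSO3inv] a right inverse of [FSO3] on [B N]. The coefficients
    given by [fspan] are arbitrary outside [J N], so they are cut off there. *)
Lemma FSO3_surj N : set_surj (ell (J N)) (B N) (@FSO3 R).
Proof.
move=> f [c ->]; exists (fun p => if p \in J N then c p else 0).
  by move=> p Jp; rewrite memNset.
apply/funext => Q; rewrite /FSO3 -(fsbig_widen (J N)); first last.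
- by move=> p [_ /= Jp]; rewrite /= memNset // mul0r.
- by move=> p [].
by apply: eq_fsbigr => p ->.
Qed.
End DoubleFourierSphere.

Theorem theorem3p3 (R : realType) (N : nat) :
  (forall f : SO3 R -> R[i], B N f -> T N (DFS f)) /\
  (forall f : SO3 R -> R[i], B N f -> DFS f = FT3 (Wmx N (FSO3inv N f))) /\
  (forall (f : SO3 R -> R[i]) (fh : nat * int * int -> R[i]),
     B N f -> ell (J N) fh -> FSO3 fh = f ->
     forall alpha beta gamma : R,
       f (phi (alpha, beta, gamma)) =
       \sum_(m \in box N) Wmx N fh m * torus_exp m (alpha, beta, gamma)).
Proof.
have invK f : B N f -> FSO3 (FSO3inv N f) = f :> (SO3 R -> R[i]).
  by move=> Bf; rewrite /FSO3inv (surjpK _ (@FSO3_surj R N)) //; exact: mem_set.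
have inv_ell f : B N f -> ell (J N) (FSO3inv (R := R) N f).
  by move=> Bf; apply: (surjpinv_image_sub (@FSO3_surj R N)); exists f.
split; [|split].
- move=> f Bf; exists (Wmx N (FSO3inv N f)); apply/funext => x.
  by rewrite /DFS /= -{1}(invK f Bf) (FSO3_phi _ (inv_ell f Bf)).
- move=> f Bf; apply/funext => x.
  rewrite /DFS /= -{1}(invK f Bf) (FSO3_phi _ (inv_ell f Bf)) /FT3.
  by apply: fsbig_widen => // m [_ mN]; rewrite /= Wmx_outside // mul0r.
- by move=> f fh _ fhJ <- a b c; exact: FSO3_phi.
Qed.
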